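(* Let $\alpha\in\mathbb{Z}[i]$ be nonzero, let $L=\mathbb{Z}[i]/\alpha\mathbb{Z}[i]$, and let $(X,(R_i)_{i\in I})$ be the association scheme with $X=L$ whose relations $(R_i)_{i\in I}$ are the orbitals of the group $\mathcal{H}=\mathcal{G}\ltimes\mathcal{T}$ acting on $L$. Then $(X,(R_i)_{i\in I})$ is primitive if and only if $\alpha$ is a prime in $\mathbb{Z}[i]$.
   Context: $\mathcal{G}=\langle i\rangle=\{\pm1,\pm i\}$ is the group of units of the Gaussian integers $\mathbb{Z}[i]$ ($i$ the imaginary unit), acting on $L$ by multiplication; $\mathcal{T}$ is the group of translations $x\mapsto x+\beta$ ($\beta\in L$) of $L$; $\mathcal{H}=\mathcal{G}\ltimes\mathcal{T}$ is regarded as the permutation group on $L$ generated by $x\mapsto ix$ and the translations. It acts transitively on $L$. The orbitals are the orbits of the induced action of $\mathcal{H}$ on $L\times L$; equivalently, the relations $R_k$ correspond to the $\mathcal{G}$-orbits $O_k$ on $L$ via $(x,y)\in R_k\Leftrightarrow x-y\in O_k$, with $O_0=\{0\}$. They form an association scheme on $L$. Let $X$ be a finite set. A $d$-class association scheme is a pair $(X,(R_i)_{i\in I})$, $I=\{0,1,\dots,d\}$, such that: (1) $(R_i)_{i\in I}$ is a partition of $X\times X$; (2) for every $i\in I$ there is $j\in I$ with $R_i^t=R_j$, where $R_i^t=\{(y,x) : (x,y)\in R_i\}$; (3) $R_0=\{(x,x) : x\in X\}$; (4) there are numbers $p_{ij}^k$ such that for any $(x,y)\in R_k$ the number of $z\in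 X$ with $(x,z)\in R_i$ and $(z,y)\in R_j$ equals $p_{ij}^k$; (5) $p_{ij}^k=p_{ji}^k$ for all $i,j,k\in I$. An association scheme is imprimitive if some union of its relations is an equivalence relation on $X$ distinct from the trivial ones (the identity relation $R_0$ and the full relation $X\times X$); it is primitive if it is not imprimitive.
   Formalization: The formal statement additionally assumes that α is not a unit: for a unit, L is a single point, so the scheme is primitive by the given definition although α is not a prime, and the equivalence fails. *)

(* Defs.v *)
From HB Require Import structures.
From mathcomp Require Import all_boot all_order all_algebra all_fingroup.
From mathcomp Require Import algC ring_quotient generic_quotient boolp ring.

Set Implicit Arguments.
Unset Strict Implicit.
Unset Printing Implicit Defensive.

Import Order.TTheory GRing.Theory Num.Theory.
Local Open Scope ring_scope.

Record assoc_scheme (X : finType) (d : nat) := AssocScheme {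
  srel :> 'I_d.+1 -> {set X * X};
  srel_inj : injective srel;
  srel_partition : partition [set srel i | i : 'I_d.+1] [set: X * X];
  srel_transpose : forall i, exists j, [set (p.2, p.1) | p in srel i] = srel j;
  srel_diag : srel ord0 = [set p | p.1 == p.2];
  inter_num : 'I_d.+1 -> 'I_d.+1 -> 'I_d.+1 -> nat;
  inter_numP : forall i j k x y, (x, y) \in srel k ->
    #|[set z | ((x, z) \in srel i) && ((z, y) \in srel j)]| = inter_num i j k;
  inter_numC : forall i j k, inter_num i j k = inter_num j i k
}.

(* [reflexive] quantifies over all of X, so the empty union is excluded when X
   is nonempty. *)
Definition equivalence_set (X : finType) (E : {set X * X}) : Prop :=
  let r : rel X := fun x y => (x, y) \in E in
  [/\ reflexive r, symmetric r & transitive r].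

Definition imprimitive (X : finType) (d : nat) (S : assoc_scheme X d) : Prop :=
  exists J : {set 'I_d.+1}, let E := \bigcup_(i in J) S i in
  [/\ equivalence_set E, E <> S ord0 & E <> [set: X * X]].

Definition primitive (X : finType) (d : nat) (S : assoc_scheme X d) : Prop :=
  ~ imprimitive S.

Section Orbitals.
Variable X : finType.

Definition pair_act (p : X * X) (s : {perm X}) : X * X := (s p.1, s p.2).

Lemma pair_act_id p : pair_act p 1%g = p.
Proof. by case: p => x y; rewrite /pair_act !perm1. Qed.

Lemma pair_actM p : act_morph pair_act p.
Proof. by move=> s t; rewrite /pair_act !permM. Qed.

Canonical pair_action := TotalAction pair_act_id pair_actM.

Definition orbitals (G : {set {perm X}}) : {set {set X * X}} :=
  [set orbit pair_action G p | p : X * X].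

End Orbitals.

Section Divisibility.
Variable R : comUnitRingType.

Definition divides (a b : R) : Prop := exists c, b = a * c.

Definition prime_elem (p : R) : Prop :=
  [/\ p != 0, p \isn't a GRing.unit &
      forall a b, divides p (a * b) -> divides p a \/ divides p b].

Definition principal (a : R) : {pred R} := [pred x | `[< divides a x >]].

Lemma principal_zmod_closed a : zmod_closed (principal a).
Proof.
split=> [|x y]; rewrite !inE; first by apply/asboolP; exists 0; rewrite mulr0.
move=> /asboolP[b ->] /asboolP[c ->]; apply/asboolP; exists (b - c).
by rewrite mulrBr.
Qed.

HB.instance Definition _ a :=
  GRing.isZmodClosed.Build R (principal a) (principal_zmod_closed a).

End Divisibility.

Definition gaussInteger_pred : pred algC :=
  fun z => ('Re z \in Num.int) && ('Im z \in Num.int).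

Definition gaussInteger : qualifier 1 algC :=
  [qualify a z | gaussInteger_pred z].

Lemma gaussIntegerE z :
  (z \is a gaussInteger) = ('Re z \in Num.int) && ('Im z \in Num.int).
Proof. by []. Qed.

Lemma gaussInteger_subring : subring_closed gaussInteger.
Proof.
have real1 : (1 : algC) \is Num.real by apply: rpred1.
split=> [|x y|x y]; rewrite !gaussIntegerE.
- by rewrite (Creal_ReP _ real1) (Creal_ImP _ real1) rpred1 rpred0.
- by move=> /andP[? ?] /andP[? ?]; rewrite !raddfB /= !rpredB.
- move=> /andP[? ?] /andP[? ?]; rewrite ReM ImM.
  by apply/andP; split; [apply: rpredB | apply: rpredD]; apply: rpredM.
Qed.

HB.instance Definition _ :=
  GRing.isSubringClosed.Build algC gaussInteger_pred gaussInteger_subring.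

Record gaussInt := GaussInt { gauss_val : algC; gauss_valP : gauss_val \is a gaussInteger }.

HB.instance Definition _ := [isSub for gauss_val].
HB.instance Definition _ := [Choice of gaussInt by <:].
HB.instance Definition _ := [SubChoice_isSubComNzRing of gaussInt by <:].
HB.instance Definition _ := GRing.isZmodMorphism.Build gaussInt algC gauss_val
  (raddfB (val : gaussInt -> algC)).
HB.instance Definition _ := GRing.isMonoidMorphism.Build gaussInt algC gauss_val
  (rmorph1 (val : gaussInt -> algC), rmorphM (val : gaussInt -> algC)).

Definition gauss_unit : pred gaussInt :=
  [pred x | (x != 0) && ((gauss_val x)^-1 \is a gaussInteger)].

Definition gauss_inv (x : gaussInt) : gaussInt :=
  if x \in gauss_unit then insubd x (gauss_val x)^-1 else x.

Lemma gauss_val_eq0 (x : gaussInt) : (gauss_val x == 0) = (x == 0).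
Proof. by rewrite -(inj_eq val_inj) /=. Qed.

Lemma gauss_mulVr : {in gauss_unit, left_inverse 1 gauss_inv *%R}.
Proof.
move=> x xU; apply: val_inj; rewrite /gauss_inv xU.
case/andP: xU => x0 xV; rewrite rmorphM rmorph1 /= insubdK //.
by rewrite mulVf // gauss_val_eq0.
Qed.

Lemma gauss_unitP (x y : gaussInt) : y * x = 1 -> gauss_unit x.
Proof.
move=> /(congr1 gauss_val); rewrite rmorphM rmorph1 /= => yx1.
have x0 : gauss_val x != 0.
  by apply/eqP => x0; move/eqP: yx1; rewrite x0 mulr0 eq_sym oner_eq0.
by rewrite /gauss_unit /= -gauss_val_eq0 x0 -[_^-1]mul1r -yx1 mulfK // gauss_valP.
Qed.

Lemma gauss_inv_out : {in [predC gauss_unit], gauss_inv =1 id}.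
Proof. by move=> x /negPf; rewrite /gauss_inv => ->. Qed.

HB.instance Definition _ := GRing.ComNzRing_hasMulInverse.Build gaussInt
  gauss_mulVr gauss_unitP gauss_inv_out.

Lemma gauss_integral (x y : gaussInt) : x * y = 0 -> (x == 0) || (y == 0).
Proof.
move=> /(congr1 gauss_val) /eqP; rewrite rmorphM rmorph0 mulf_eq0 /=.
by rewrite !gauss_val_eq0.
Qed.

HB.instance Definition _ :=
  GRing.ComUnitRing_isIntegral.Build gaussInt gauss_integral.

Lemma gauss_i_subproof : 'i \is a gaussInteger.
Proof. by rewrite gaussIntegerE Re_i Im_i rpred0 rpred1. Qed.

Definition gauss_i : gaussInt := GaussInt gauss_i_subproof.

Lemma gauss_ii : gauss_i * gauss_i = - 1.
Proof.
by apply: val_inj; rewrite rmorphM rmorphN rmorph1 /= -expr2 sqrCi.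
Qed.

Definition gauss_rect (a b : int) : gaussInt := a%:~R + gauss_i * b%:~R.
Definition gauss_re (z : gaussInt) : int := Num.floor ('Re (gauss_val z)).
Definition gauss_im (z : gaussInt) : int := Num.floor ('Im (gauss_val z)).

Lemma gaussE z : z = gauss_rect (gauss_re z) (gauss_im z).
Proof.
apply: val_inj; rewrite rmorphD rmorphM !rmorph_int /=.
have /andP[reZ imZ] : ('Re (gauss_val z) \in Num.int) && ('Im (gauss_val z) \in Num.int).
  by rewrite -gaussIntegerE gauss_valP.
by rewrite !floorK // -Crect.
Qed.

Definition gauss_norm (z : gaussInt) : nat :=
  absz (gauss_re z ^+ 2 + gauss_im z ^+ 2)%R.

Lemma gauss_norm_gt0 z : z != 0 -> (0 < gauss_norm z)%N.
Proof.
move=> z0; rewrite absz_gt0; apply: contra_neq z0 => /eqP.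
rewrite paddr_eq0 ?sqr_ge0 // !sqrf_eq0 => /andP[/eqP a0 /eqP b0].
by rewrite (gaussE z) a0 b0 /gauss_rect mulr0 addr0.
Qed.

Lemma divides_gauss_norm z : divides z (gauss_norm z)%:R.
Proof.
rewrite {1}(gaussE z) /gauss_norm.
set a := gauss_re _; set b := gauss_im _.
exists (gauss_rect a (- b)).
rewrite pmulrn gez0_abs ?addr_ge0 ?sqr_ge0 // /gauss_rect rmorphN rmorphD.
rewrite !rmorphXn /= mulrN mulrC -subr_sqr exprMn [gauss_i ^+ 2]expr2 gauss_ii.
by rewrite mulN1r opprK.
Qed.

(* The quotient is only taken as an additive group, so that it makes sense for
   units too. The argument alpha0 is there for the finType instance below. *)
Definition gauss_quot (alpha : gaussInt) (alpha0 : alpha != 0) : Type :=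
  Quotient.quot (principal alpha).

Section GaussQuotient.
Variables (alpha : gaussInt) (alpha0 : alpha != 0).
Local Notation L := (gauss_quot alpha0).

HB.instance Definition _ := Choice.on L.
HB.instance Definition _ := GRing.Zmodule.on L.

Definition gauss_class (z : gaussInt) : L :=
  \pi_(Quotient.quot (principal alpha))%qT z.

Lemma gauss_class_is_zmod_morphism : zmod_morphism gauss_class.
Proof. exact: raddfB. Qed.

HB.instance Definition _ := GRing.isZmodMorphism.Build gaussInt L gauss_class
  gauss_class_is_zmod_morphism.

Definition gauss_repr (x : L) : gaussInt :=
  repr (x : Quotient.quot (principal alpha)).

Lemma gauss_reprK : cancel gauss_repr gauss_class.
Proof. exact: reprK. Qed.

Lemma gauss_classP x y :
  gauss_class x = gauss_class y <-> divides alpha (x - y).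
Proof.
split=> [/eqP|xy]; first by rewrite -Quotient.idealrBE inE => /asboolP.
by apply/eqP; rewrite -Quotient.idealrBE inE; apply/asboolP.
Qed.

Let N := gauss_norm alpha.

Definition gauss_code (x : L) : 'I_N.+1 * 'I_N.+1 :=
  (inord (absz (gauss_re (gauss_repr x) %% N)%Z),
   inord (absz (gauss_im (gauss_repr x) %% N)%Z)).

Definition gauss_decode (p : 'I_N.+1 * 'I_N.+1) : L :=
  gauss_class (gauss_rect (p.1 : nat) (p.2 : nat)).

Lemma gauss_codeK : cancel gauss_code gauss_decode.
Proof.
move=> x; rewrite -[RHS]gauss_reprK; apply/gauss_classP.
rewrite /gauss_code; set z := gauss_repr x.
have N0 : N != 0 :> int by rewrite eqz_nat -lt0n gauss_norm_gt0.
have modE (a : int) : (inord (absz (a %% N)%Z) : 'I_N.+1) = (a %% N)%Z :> int.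
  have a_ge0 : 0 <= (a %% N)%Z by apply: modz_ge0.
  rewrite inordK; first by rewrite gez0_abs.
  by rewrite ltnS -lez_nat gez0_abs // ltW // ltz_mod.
rewrite /= !modE {3}[z]gaussE.
have [c Nc] := divides_gauss_norm alpha.
exists (- (c * gauss_rect (gauss_re z %/ N)%Z (gauss_im z %/ N)%Z)).
rewrite mulrN mulrA -Nc /gauss_rect.
have divE (a : int) :
    a%:~R = (a %/ N)%Z%:~R * N%:R + (a %% N)%Z%:~R :> gaussInt.
  by rewrite {1}(divz_eq a N) rmorphD rmorphM /= -pmulrn.
by rewrite (divE (gauss_re z)) (divE (gauss_im z)) /N; ring.
Qed.

HB.instance Definition _ : isCountable L := CanIsCountable gauss_codeK.
HB.instance Definition _ : isFinite L := CanIsFinite gauss_codeK.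

(* The action of Z[i] on the quotient by multiplication; see gauss_scale_class
   for its independence of the chosen representative. *)
Definition gauss_scale (u : gaussInt) (x : L) : L :=
  gauss_class (u * gauss_repr x).

Lemma gauss_scale_class u z : gauss_scale u (gauss_class z) = gauss_class (u * z).
Proof.
apply/gauss_classP; rewrite -mulrBr.
have /gauss_classP[c ->] := gauss_reprK (gauss_class z).
by exists (u * c); rewrite mulrCA.
Qed.

Lemma gauss_scaleA u v x : gauss_scale u (gauss_scale v x) = gauss_scale (u * v) x.
Proof. by rewrite -[x]gauss_reprK !gauss_scale_class mulrA. Qed.

Lemma gauss_scale1 x : gauss_scale 1 x = x.
Proof. by rewrite /gauss_scale mul1r gauss_reprK. Qed.

Lemma gauss_scale_i_inj : injective (gauss_scale gauss_i).
Proof.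
apply: (can_inj (g := gauss_scale (- gauss_i))) => x.
by rewrite gauss_scaleA mulNr gauss_ii opprK gauss_scale1.
Qed.

Definition gauss_rot : {perm L} := perm gauss_scale_i_inj.

Definition gauss_trans (b : L) : {perm L} := perm (addIr b).

Definition gauss_group : {group {perm L}} :=
  <<gauss_rot |: [set gauss_trans b | b : L]>>%G.

End GaussQuotient.

Section GaussScheme.
Variables (alpha : gaussInt) (alpha0 : alpha != 0).
Local Notation L := (gauss_quot alpha0).
Local Notation H := (gauss_group alpha0).
Local Notation P := (orbitals H).

Lemma gauss_transE (b x : L) : gauss_trans b x = x + b.
Proof. by rewrite permE. Qed.

Lemma gauss_trans_in (b : L) : gauss_trans b \in H.
Proof. by apply: mem_gen; rewrite !inE imset_f ?orbT. Qed.

Lemma orbitals_partition : partition P [set: L * L].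
Proof.
have -> : P = [set orbit (pair_action L) H p | p in [set: L * L]].
  by apply/setP => E; apply/imsetP/imsetP => -[p _ ->]; exists p.
by apply: orbit_partition; apply/actsP => s _ p; rewrite !inE.
Qed.

Lemma orbital_act (E : {set L * L}) s p :
  E \in P -> s \in H -> (pair_act p s \in E) = (p \in E).
Proof.
by move=> /imsetP[q _ ->] sH; rewrite (orbit_actr (pair_action L)).
Qed.

Lemma orbital_addr (E : {set L * L}) x y b :
  E \in P -> ((x + b, y + b) \in E) = ((x, y) \in E).
Proof.
move=> EP; rewrite -(orbital_act (x, y) EP (gauss_trans_in b)).
by rewrite /pair_act /= !gauss_transE.
Qed.

Lemma orbital_transpose (E : {set L * L}) :
  E \in P -> [set (p.2, p.1) | p in E] \in P.
Proof.
move=> /imsetP[q _ ->]; apply/imsetP; exists (q.2, q.1) => //.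
by rewrite /orbit -imset_comp; apply: eq_imset => s.
Qed.

Lemma diag_orbital : [set p : L * L | p.1 == p.2] \in P.
Proof.
apply/imsetP; exists (0, 0) => //; apply/setP => -[x y]; rewrite inE /=.
apply/eqP/imsetP => [->|[s _ [-> ->//]]].
exists (gauss_trans y); first exact: gauss_trans_in.
by rewrite /= /pair_act /= gauss_transE add0r.
Qed.

Lemma orbital_inter_num (E1 E2 E : {set L * L}) p q :
  E1 \in P -> E2 \in P -> E \in P -> p \in E -> q \in E ->
  #|[set z | ((p.1, z) \in E1) && ((z, p.2) \in E2)]| =
  #|[set z | ((q.1, z) \in E1) && ((z, q.2) \in E2)]|.
Proof.
move=> P1 P2 /imsetP[r _ ->] pE qE.
have /orbitP[s sH <-] : q \in orbit (pair_action L) H p.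
  by rewrite (orbit_eqP (to := pair_action L) pE).
rewrite -(card_imset _ (@perm_inj _ s)); apply: eq_card => z.
rewrite -[z](permKV s) mem_imset ?inE; last exact: perm_inj.
rewrite -(orbital_act (p.1, _) P1 sH) -(orbital_act (_, p.2) P2 sH).
by [].
Qed.

Lemma orbital_inter_numC (E1 E2 : {set L * L}) p :
  E1 \in P -> E2 \in P ->
  #|[set z | ((p.1, z) \in E1) && ((z, p.2) \in E2)]| =
  #|[set z | ((p.1, z) \in E2) && ((z, p.2) \in E1)]|.
Proof.
move=> P1 P2; set f : L -> L := fun z => p.1 + p.2 - z.
have fK : involutive f by move=> z; rewrite /f opprB addrC subrK.
rewrite -(card_imset _ (inv_inj fK)); apply: eq_card => z.
rewrite -[z]fK mem_imset ?inE; last exact: inv_inj.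
rewrite fK -(orbital_addr p.1 z (p.2 - z) P2) -(orbital_addr z p.2 (p.1 - z) P1).
have E12 : p.1 + (p.2 - z) = f z by rewrite addrA.
have E21 : p.2 + (p.1 - z) = f z by rewrite addrA [p.2 + _]addrC.
by rewrite E12 E21 ![z + (_ - _)]addrC !subrK andbC.
Qed.

Lemma orbital_scheme_exists :
  exists (d : nat) (S : assoc_scheme L d), [set S i | i : 'I_d.+1] = P.
Proof.
set D := [set p : L * L | p.1 == p.2].
pose s := enum (P :\ D); pose d := size s.
pose r (i : 'I_d.+1) := nth D (D :: s) i.
have rP i : r i \in P.
  rewrite /r; have := mem_nth D (ltn_ord i : (i < size (D :: s))%N).
  rewrite inE mem_enum !inE => /orP[/eqP-> | /andP[_ //]].
  exact: diag_orbital.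
have r_inj : injective r.
  move=> i j /eqP; rewrite nth_uniq ?ltn_ord //; first by move/eqP/val_inj.
  by rewrite /= mem_enum !inE eqxx enum_uniq.
have r_onto E : E \in P -> exists i, E = r i.
  move=> EP; have Es : E \in D :: s.
    by rewrite inE mem_enum !inE EP andbT orbN.
  have Ei : (index E (D :: s) < d.+1)%N by rewrite -[d.+1]/(size (D :: s)) index_mem.
  by exists (Ordinal Ei); rewrite /r /= -[RHS]/(nth D (D :: s) _) nth_index.
have imr : [set r i | i : 'I_d.+1] = P.
  apply/setP => E; apply/imsetP/idP => [[i _ ->] //|/r_onto[i ->]].
  by exists i.
have r0 i : exists p, p \in r i.
  by have /imsetP[p _ ->] := rP i; exists p; apply: (orbit_refl (pair_action L)).
pose w i := xchoose (r0 i).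
pose c i j k := #|[set z | (((w k).1, z) \in r i) && ((z, (w k).2) \in r j)]|.
have cP i j k x y : (x, y) \in r k ->
    #|[set z | ((x, z) \in r i) && ((z, y) \in r j)]| = c i j k.
  move=> xy; apply: (orbital_inter_num (p := (x, y)) (rP i) (rP j) (rP k)) => //.
  exact: (xchooseP (r0 k)).
have cC i j k : c i j k = c j i k by apply: orbital_inter_numC.
have part : partition [set r i | i : 'I_d.+1] [set: L * L].
  by rewrite imr orbitals_partition.
have tr i : exists j, [set (p.2, p.1) | p in r i] = r j.
  exact: r_onto (orbital_transpose (rP i)).
by exists d, (AssocScheme r_inj part tr (erefl _) cP cC).
Qed.

End GaussScheme.

(* Main.v *)
Require Import Defs.
From mathcomp Require Import all_boot all_order all_algebra all_fingroup.

Set Implicit Arguments.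
Unset Strict Implicit.
Unset Printing Implicit Defensive.

Import GRing.Theory.
Local Open Scope ring_scope.

(** The unions of orbitals are the relations invariant under translations and
multiplication by i, so the equivalence relations among them are the
congruences [x - y \in K], where K runs over the additive subgroups of L stable
under i, that is, over the ideals of Z[i] / alpha ([primitive_submodP]).
Primitivity therefore says that the ring Z[i] / alpha has no ideals besides 0
and itself, and it remains to see that this holds exactly when alpha is prime
([trivial_submodsP]).

If there are no other ideals and alpha divides a * b, apply this to the
annihilator of b: it contains a, so it is 0 only if alpha divides a, and it
contains 1 as soon as it is everything, in which case alpha divides b.
Conversely, if alpha is prime, multiplication by a nonzero x is injective on L,
hence surjective because L is finite; so 1 is a multiple of x, and an ideal
containing x is everything. *)

Section GaussSubmodules.
Variables (alpha : gaussInt) (alpha0 : alpha != 0).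
Local Notation L := (gauss_quot alpha0).
Local Notation H := (gauss_group alpha0).
Local Notation P := (orbitals H).
Implicit Types (K : {set L}) (E : {set L * L}).

(** As Z[i] is generated by i, these are the Z[i]-submodules of L, that is, the
ideals of Z[i] / alpha ([gauss_submodZ]).  Only stability under i is asked for
because it is what invariance under [gauss_rot] provides. *)
Definition gauss_submod K : Prop :=
  zmod_closed K /\ {in K, forall x, gauss_scale gauss_i x \in K}.

Definition congruence K : {set L * L} := [set p | p.1 - p.2 \in K].

Lemma gauss_scaleD u : {morph @gauss_scale _ alpha0 u : x y / x + y}.
Proof.
move=> x y; rewrite -[x]gauss_reprK -[y]gauss_reprK -raddfD.
by rewrite !gauss_scale_class mulrDr raddfD.
Qed.

Lemma gauss_scaleN u : {morph @gauss_scale _ alpha0 u : x / - x}.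
Proof.
move=> x; rewrite -[x]gauss_reprK -raddfN !gauss_scale_class mulrN.
by rewrite raddfN.
Qed.

Lemma gauss_scaleB u : {morph @gauss_scale _ alpha0 u : x y / x - y}.
Proof. by move=> x y; rewrite gauss_scaleD gauss_scaleN. Qed.

Lemma gauss_scale0 u : gauss_scale u 0 = 0 :> L.
Proof. by rewrite -[X in gauss_scale u X](subrr 0) gauss_scaleB subrr. Qed.

Lemma gauss_class_eq0 z : gauss_class alpha0 z = 0 <-> divides alpha z.
Proof. by rewrite -(raddf0 (gauss_class alpha0)) gauss_classP subr0. Qed.

Lemma gauss_submodZ K u x : gauss_submod K -> x \in K -> gauss_scale u x \in K.
Proof.
move=> [Kzmod Ki] xK.
have [K0 KD] := GRing.zmod_closedD Kzmod; have KN := GRing.zmod_closedN Kzmod.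
have Kint (n : int) y : y \in K -> y *~ n \in K.
  move=> yK; have Knat (m : nat) : y *+ m \in K.
    by elim: m => [|m IHm]; rewrite ?mulr0n // mulrS KD.
  by case: n => m; [apply: Knat | apply: KN; apply: Knat].
have -> : gauss_scale u x =
    x *~ gauss_re u + gauss_scale gauss_i x *~ gauss_im u.
  rewrite -[x]gauss_reprK !gauss_scale_class -!raddfMz -raddfD {1}(gaussE u).
  congr gauss_class.
  by rewrite /gauss_rect mulrDl mulrzl mulrAC mulrzr.
by apply: KD; apply: Kint => //; apply: Ki.
Qed.

Lemma congruence_equivalence K : zmod_closed K -> equivalence_set (congruence K).
Proof.
move=> Kzmod; have [K0 KD] := GRing.zmod_closedD Kzmod.
have KN := GRing.zmod_closedN Kzmod.
split=> [x|x y|y x z]; rewrite !inE /= ?subrr //.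
  by apply/idP/idP => /KN; rewrite opprB.
by move=> xy yz; have := KD _ _ xy yz; rewrite addrA subrK.
Qed.

(** It is enough to check invariance on the generators, since the stabiliser of
a relation in the symmetric group of L is a subgroup. *)
Lemma congruence_invariant K p s :
  gauss_submod K -> p \in congruence K -> s \in H ->
  pair_act p s \in congruence K.
Proof.
move=> [_ Ki] pK sH.
suff /subsetP/(_ s sH) sN : H \subset ('N(congruence K | pair_action L))%g.
  by have := astabs_act p sN; rewrite /= pK.
rewrite gen_subG; apply/subsetP => t; rewrite !inE => /orP[/eqP->|].
  apply/subsetP => -[x y]; rewrite !inE /= !permE => xyK.
  by rewrite -gauss_scaleB Ki.
case/imsetP => b _ ->; apply/subsetP => -[x y]; rewrite !inE /= !permE.
by rewrite opprD addrACA subrr addr0.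
Qed.

Section Scheme.
Variables (d : nat) (S : assoc_scheme L d).
Hypothesis S_orbitals : [set S k | k : 'I_d.+1] = P.

Lemma scheme_orbital k : S k \in P.
Proof. by rewrite -S_orbitals imset_f. Qed.

Lemma congruence_bigcup K : gauss_submod K ->
  exists J : {set 'I_d.+1}, congruence K = \bigcup_(k in J) S k.
Proof.
move=> Ksub; exists [set k | S k \subset congruence K].
apply/setP => p; apply/idP/bigcupP => [pK|[k]]; last first.
  by rewrite inE => /subsetP; apply.
have /imsetP[k _ Sk] : orbit (pair_action L) H p \in [set S k | k : 'I_d.+1].
  by rewrite S_orbitals imset_f.
exists k; last by rewrite -Sk orbit_refl.
rewrite inE -Sk; apply/subsetP => q /orbitP[s sH <-].
exact: congruence_invariant.
Qed.

Lemma bigcup_addr (J : {set 'I_d.+1}) x y b :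
  let E := \bigcup_(k in J) S k in
  ((x + b, y + b) \in E) = ((x, y) \in E).
Proof.
by apply/bigcupP/bigcupP => -[k kJ xyk]; exists k;
  rewrite ?orbital_addr ?scheme_orbital // in xyk *.
Qed.

Lemma bigcup_congruence (J : {set 'I_d.+1}) :
  let E := \bigcup_(k in J) S k in equivalence_set E ->
  exists2 K, gauss_submod K & E = congruence K.
Proof.
move=> E [Erefl Esym Etrans].
have EB x y : ((x - y, 0) \in E) = ((x, y) \in E).
  by rewrite -(bigcup_addr _ _ _ y) subrK add0r.
exists [set x | (x, 0) \in E]; last by apply/setP => -[x y]; rewrite !inE /= EB.
split=> [|x]; last first.
  rewrite !inE => /bigcupP[k kJ xk]; apply/bigcupP; exists k => //.
  have rotH : gauss_rot alpha0 \in H by apply: mem_gen; rewrite !inE eqxx.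
  have := orbital_act (x, 0) (scheme_orbital k) rotH.
  by rewrite /pair_act /= !permE gauss_scale0 xk.
split=> [|x y]; rewrite !inE; first exact: Erefl.
by rewrite EB => x0 y0; apply: Etrans x0 _; rewrite Esym.
Qed.

Lemma congruence_set0 : congruence [set 0] = S ord0.
Proof. by rewrite srel_diag; apply/setP => p; rewrite !inE subr_eq0. Qed.

Lemma congruence_setT : congruence setT = setT.
Proof. by apply/setP => p; rewrite !inE. Qed.

Lemma congruence_inj : injective congruence.
Proof.
by move=> K K' /setP eqK; apply/setP => x; have := eqK (x, 0); rewrite !inE subr0.
Qed.

Lemma primitive_submodP :
  primitive S <-> forall K, gauss_submod K -> K = [set 0] \/ K = setT.
Proof.
split=> [prim K Ksub|triv [J [/bigcup_congruence[K Ksub ->]]]]; last first.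
  by case: (triv K Ksub) => ->; rewrite ?congruence_set0 ?congruence_setT.
have [->|K_neq0] := eqVneq K [set 0]; first by left.
have [->|K_neqT] := eqVneq K setT; first by right.
case: prim; have [J KJ] := congruence_bigcup Ksub; exists J => /=.
rewrite -KJ; split; first by apply: congruence_equivalence; case: Ksub.
  by rewrite -congruence_set0 => /congruence_inj/eqP; apply/negP.
by rewrite -congruence_setT => /congruence_inj/eqP; apply/negP.
Qed.

End Scheme.

Definition annihilator b : {set L} := [set x | gauss_scale b x == 0].

Lemma annihilator_submod b : gauss_submod (annihilator b).
Proof.
split; first split=> [|x y]; rewrite ?inE ?gauss_scale0 //.
  by rewrite gauss_scaleB => /eqP-> /eqP->; rewrite subr0.
move=> x; rewrite !inE gauss_scaleA mulrC -gauss_scaleA => /eqP->.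
by rewrite gauss_scale0.
Qed.

Lemma mem_annihilator b z :
  gauss_class alpha0 z \in annihilator b <-> divides alpha (z * b).
Proof.
by rewrite inE gauss_scale_class mulrC -gauss_class_eq0; split=> /eqP.
Qed.

(** For alpha prime, the ring Z[i] / alpha is an integral domain. *)
Lemma gauss_scale_inj z :
  prime_elem alpha -> ~ divides alpha z -> injective (@gauss_scale _ alpha0 z).
Proof.
move=> [_ _ alphaP] Nz x y; rewrite -[x]gauss_reprK -[y]gauss_reprK.
rewrite !gauss_scale_class => /gauss_classP; rewrite -mulrBr.
by case/alphaP => // xy; apply/gauss_classP.
Qed.

Lemma trivial_submodsP : alpha \isn't a GRing.unit ->
  (forall K, gauss_submod K -> K = [set 0] \/ K = setT) <-> prime_elem alpha.
Proof.
move=> alphaU; split=> [triv|alphaP K Ksub].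
  split=> // a b ab; have aK := (mem_annihilator b a).2 ab.
  have [K0|KT] := triv _ (annihilator_submod b).
    by left; apply/gauss_class_eq0/set1P; rewrite -K0.
  by right; rewrite -[b]mul1r; apply/mem_annihilator; rewrite KT inE.
have [KT|[x xK xN0]] : K \subset [set 0] \/ exists2 x, x \in K & x != 0.
- have [|/subsetPn[x xK]] := boolP (K \subset [set 0]); first by left.
  by rewrite inE; right; exists x.
- by left; apply/eqP; rewrite eqEsubset KT sub1set; case: Ksub => -[].
right; apply/setP => y; rewrite [RHS]inE.
have xNdiv : ~ divides alpha (gauss_repr x).
  by move/(gauss_class_eq0 _).2/eqP; rewrite gauss_reprK (negPf xN0).
have [g _ xgK] := injF_bij (gauss_scale_inj alphaP xNdiv).
(* The scalar is read off as a representative of the solution of x * g y = y,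
   the product in L being commutative. *)
rewrite -(xgK y) -[g y]gauss_reprK gauss_scale_class mulrC.
by rewrite -gauss_scale_class gauss_reprK gauss_submodZ.
Qed.

End GaussSubmodules.

Theorem theorem5 (alpha : gaussInt) (alpha_neq0 : alpha != 0)
    (alpha_nonunit : alpha \isn't a GRing.unit)
    (d : nat) (S : assoc_scheme (gauss_quot alpha_neq0) d)
    (S_orbitals :
      [set S k | k : 'I_d.+1] = orbitals (gauss_group alpha_neq0)) :
  primitive S <-> prime_elem alpha.
Proof.
rewrite (primitive_submodP S_orbitals).
exact: trivial_submodsP.
Qed.
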